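(* Let $k\in\{1,2,\ldots\}$. Then the linear subspace $H_{\mathrm{ReLU}^k}(\mathbb{R})$ is dense in $\mathcal{Y}_k(\mathbb{R})$ with respect to the norm $\|\cdot\|_{\mathcal{Y}_k}$.
   Context: Functions are complex-valued and linear spans are taken over $\mathbb{C}$. For $x\in\mathbb{R}$ and $k\in\{1,2,\ldots\}$, $\mathrm{ReLU}(x)=\max(0,x)$ and $\mathrm{ReLU}^k(x)=\mathrm{ReLU}(x)^k$ (the $k$-th power). $\mathcal{Y}_k(\mathbb{R})$ is the space of all continuous functions $f$ on $\mathbb{R}$ for which both limits $\lim_{x\to\infty}\frac{f(x)}{1+|x|^k}$ and $\lim_{x\to-\infty}\frac{f(x)}{1+|x|^k}$ exist (as finite numbers, not necessarily equal), equipped with the norm $$\|f\|_{\mathcal{Y}_k}=\sup_{x\in\mathbb{R}}\frac{|f(x)|}{1+|x|^k}.$$ $H_{\mathrm{ReLU}^k}(\mathbb{R})$ is the linear span of the functions $x\mapsto \mathrm{ReLU}^k(ax+b)$ with $a,b\in\mathbb{R}$, $a\neq 0$. *)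

(* Defs.v *)
From Stdlib Require Import Reals List.
From Coquelicot Require Import Coquelicot.

Open Scope R_scope.

Definition ReLU (x : R) : R := Rmax 0 x.

Definition weight (k : nat) (x : R) : R := 1 + Rabs x ^ k.

Definition in_Y (k : nat) (f : R -> C) : Prop :=
  (forall x : R, continuous f x) /\
  (exists l : C,
     filterlim (fun x : R => (f x / RtoC (weight k x))%C)
               (Rbar_locally p_infty) (locally l)) /\
  (exists l : C,
     filterlim (fun x : R => (f x / RtoC (weight k x))%C)
               (Rbar_locally m_infty) (locally l)).

(* The supremum is taken in the extended reals, so that it is [p_infty], and
   not a default real, on functions of faster growth; it is finite on [in_Y]. *)
Definition Y_norm (k : nat) (f : R -> C) : Rbar :=
  Lub_Rbar (fun y : R => exists x : R, y = Cmod (f x) / weight k x).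

(* Linear combinations of members of [S], the empty one included. *)
Definition lin_span (S : (R -> C) -> Prop) (f : R -> C) : Prop :=
  exists l : list (C * (R -> C)),
    List.Forall (fun p => S (snd p)) l /\
    forall x : R,
      f x = fold_right (fun p s => (fst p * snd p x + s)%C) (RtoC 0) l.

Definition ReLU_ridge (k : nat) (g : R -> C) : Prop :=
  exists a b : R,
    a <> 0 /\ forall x : R, g x = RtoC (ReLU (a * x + b) ^ k).

Definition in_H (k : nat) : (R -> C) -> Prop := lin_span (ReLU_ridge k).

Definition dense_subset_wrt (N : (R -> C) -> Rbar) (H Y : (R -> C) -> Prop) : Prop :=
  (forall g : R -> C, H g -> Y g) /\
  (forall f : R -> C, Y f ->
     forall eps : R, 0 < eps ->
       exists g : R -> C,
         H g /\ Rbar_lt (N (fun x : R => (f x - g x)%C)) (Finite eps)).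

(* Main.v *)
(* Subtracting multiples of [ReLU^k(x)] and [ReLU^k(-x)] from [f] removes both
   limits of [f / weight]. What remains is small against the weight outside some
   [-A, A]; there it is approximated by a staircase whose steps are scaled copies
   of a ramp [s] in [H], equal to [0] on [x <= 0] and to [1] on [x >= 1]. Since at
   most one step is in transition at any point, boundedness of [s] and uniform
   continuity of [f] control the error. The ramp comes from an identity
   [sum_j c_j (x - t_j)^k = 1] by replacing each power with [ReLU^k(x - t_j)]. *)

Require Import Defs.
From Stdlib Require Import Reals List Lra Lia.
From Coquelicot Require Import Coquelicot.

Open Scope R_scope.

(** * Elementary properties of [ReLU] and of the weight, and limits of ridge powers *)

Lemma ReLU_neg (x : R) : x <= 0 -> ReLU x = 0.
Proof. intros; unfold ReLU; now apply Rmax_left. Qed.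

Lemma ReLU_pos (x : R) : 0 <= x -> ReLU x = x.
Proof. intros; unfold ReLU; now apply Rmax_right. Qed.

Lemma ReLU_ge0 (x : R) : 0 <= ReLU x.
Proof. apply Rmax_l. Qed.

Lemma ReLU_scal (c x : R) : 0 <= c -> ReLU (c * x) = c * ReLU x.
Proof.
intros hc; destruct (Rle_dec 0 x) as [hx|hx].
- rewrite !ReLU_pos; nra.
- rewrite !ReLU_neg; nra.
Qed.

Lemma continuous_ReLU (x : R) : continuous ReLU x.
Proof.
apply continuous_ext with (fun y => (y + Rabs y) * / 2).
- intros y; unfold ReLU, Rmax, Rabs.
  destruct (Rle_dec 0 y), (Rcase_abs y); simpl; lra.
- apply @continuous_scal_l.
  apply (continuous_plus (fun y : R => y) Rabs);
    [apply continuous_id | apply continuous_Rabs].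
Qed.

Lemma continuous_pow_fun {U : UniformSpace} (f : U -> R) (n : nat) (x : U) :
  continuous f x -> continuous (fun y => f y ^ n) x.
Proof.
intros hf; induction n as [|n IH]; simpl.
- apply continuous_const.
- now apply (continuous_mult (K := R_AbsRing) f (fun y => f y ^ n)).
Qed.

Lemma continuous_affine (a b x : R) : continuous (fun y => a * y + b) x.
Proof.
apply (continuous_plus (fun y => a * y) (fun _ => b)).
- apply (continuous_mult (K := R_AbsRing) (fun _ => a) (fun y => y));
    [apply continuous_const | apply continuous_id].
- apply continuous_const.
Qed.

Lemma continuous_ReLU_pow (a b : R) (k : nat) (x : R) :
  continuous (fun y => ReLU (a * y + b) ^ k) x.
Proof.
apply continuous_pow_fun.
apply (continuous_comp (fun y => a * y + b) ReLU).
- apply continuous_affine.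
- apply continuous_ReLU.
Qed.

Lemma weight_ge1 (k : nat) (x : R) : 1 <= weight k x.
Proof. unfold weight; assert (h := pow_le _ k (Rabs_pos x)); lra. Qed.

Lemma weight_pos (k : nat) (x : R) : 0 < weight k x.
Proof. assert (h := weight_ge1 k x); lra. Qed.

Lemma weight_le (k : nat) (x y : R) : Rabs x <= Rabs y -> weight k x <= weight k y.
Proof.
intros h; unfold weight; apply Rplus_le_compat_l, pow_incr; split;
  [apply Rabs_pos | exact h].
Qed.

Lemma weight_opp (k : nat) (x : R) : weight k (- x) = weight k x.
Proof. unfold weight; now rewrite Rabs_Ropp. Qed.

(* With [t = 1/x], the quotient is [ReLU (a + b t) ^ k / (1 + t ^ k)], which is
   continuous at [t = 0]. *)
Lemma ReLU_pow_lim_p (k : nat) (a b : R) : (1 <= k)%nat ->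
  filterlim (fun x => ReLU (a * x + b) ^ k / weight k x)
    (Rbar_locally p_infty) (locally (ReLU a ^ k)).
Proof.
intros hk.
apply filterlim_ext_loc with
  (fun x => ReLU (b * / x + a) ^ k * / (1 + (/ x) ^ k)).
- exists 0; intros x hx.
  unfold weight; rewrite (Rabs_pos_eq x) by lra.
  replace (a * x + b) with (x * (b * / x + a)) by (field; lra).
  rewrite ReLU_scal, Rpow_mult_distr, pow_inv by lra.
  assert (0 < x ^ k) by now apply pow_lt.
  field; lra.
- set (phi := fun t => ReLU (b * t + a) ^ k * / (1 + t ^ k)).
  replace (ReLU a ^ k) with (phi 0).
  2:{ unfold phi; rewrite Rmult_0_r, Rplus_0_l, pow_i by lia; field. }
  apply (filterlim_comp _ _ _ Rinv phi _ (locally 0)).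
  + apply (is_lim_inv (fun x => x) p_infty p_infty); [apply is_lim_id | easy].
  + unfold phi; apply (continuous_mult (K := R_AbsRing)
      (fun t => ReLU (b * t + a) ^ k) (fun t => / (1 + t ^ k))).
    * apply continuous_ReLU_pow.
    * apply (continuous_comp (fun t => 1 + t ^ k) Rinv).
      -- apply (continuous_plus (fun _ => 1) (fun t => t ^ k));
           [apply continuous_const | apply continuous_pow_fun, continuous_id].
      -- apply continuous_Rinv; rewrite pow_i by lia; lra.
Qed.

(** The weight is even, so the reflection [x -> - x] turns this into the limit at plus infinity with
    [a] replaced by [- a]. *)
Lemma ReLU_pow_lim_m (k : nat) (a b : R) : (1 <= k)%nat ->
  filterlim (fun x => ReLU (a * x + b) ^ k / weight k x)
    (Rbar_locally m_infty) (locally (ReLU (- a) ^ k)).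
Proof.
intros hk.
apply filterlim_ext with
  (fun x => (fun y => ReLU (- a * y + b) ^ k / weight k y) (- x)).
- intros x; simpl; rewrite weight_opp; now replace (- a * - x) with (a * x) by ring.
- apply (filterlim_comp _ _ _ Ropp (fun y => ReLU (- a * y + b) ^ k / weight k y)
    _ (Rbar_locally p_infty)).
  + apply (filterlim_Rbar_opp m_infty).
  + now apply ReLU_pow_lim_p.
Qed.

(** * Complex-valued limits and the inclusion of [in_H] in [in_Y] *)

Lemma continuous_RtoC (x : R) : continuous RtoC x.
Proof.
intros P [e he]; exists e; intros y hy; apply he; split;
  [exact hy | apply ball_center].
Qed.

Section Limits_at_filter.

Context {T : Type} {F : (T -> Prop) -> Prop} {FF : Filter F}.

(** An arbitrary filter covers both continuity at a point and limits at either infinity. *)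
Lemma filterlim_Cplus (f g : T -> C) (l m : C) :
  filterlim f F (locally l) -> filterlim g F (locally m) ->
  filterlim (fun x => (f x + g x)%C) F (locally (l + m)%C).
Proof.
intros hf hg.
exact (filterlim_comp_2 _ _ _ hf hg (filterlim_plus (V := C_NormedModule) l m)).
Qed.

Lemma filterlim_Cscal (c : C) (f : T -> C) (l : C) :
  filterlim f F (locally l) ->
  filterlim (fun x => (c * f x)%C) F (locally (c * l)%C).
Proof.
intros hf.
exact (filterlim_comp _ _ _ f _ _ _ _ hf
  (filterlim_scal_r (V := C_NormedModule) c l)).
Qed.

Lemma filterlim_RtoC (f : T -> R) (l : R) :
  filterlim f F (locally l) ->
  filterlim (fun x => RtoC (f x)) F (locally (RtoC l)).
Proof.
intros hf; exact (filterlim_comp _ _ _ f RtoC _ _ _ hf (continuous_RtoC l)).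
Qed.

End Limits_at_filter.

Lemma continuous_Cplus (f g : R -> C) (x : R) :
  continuous f x -> continuous g x -> continuous (fun y => (f y + g y)%C) x.
Proof. apply filterlim_Cplus. Qed.

Lemma continuous_Cscal (c : C) (f : R -> C) (x : R) :
  continuous f x -> continuous (fun y => (c * f y)%C) x.
Proof. apply filterlim_Cscal. Qed.

Lemma weight_C_neq0 (k : nat) (x : R) : RtoC (weight k x) <> 0%C.
Proof. intros h; apply RtoC_inj in h; assert (H := weight_pos k x); lra. Qed.

Lemma in_Y_ext (k : nat) (f g : R -> C) :
  (forall x, f x = g x) -> in_Y k f -> in_Y k g.
Proof.
intros e (hc & (lp & hp) & (lm & hm)); split; [|split].
- intros x; now apply (continuous_ext f).
- exists lp; eapply filterlim_ext; [|exact hp]; intros x; simpl; now rewrite e.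
- exists lm; eapply filterlim_ext; [|exact hm]; intros x; simpl; now rewrite e.
Qed.

Lemma in_Y_zero (k : nat) : in_Y k (fun _ => RtoC 0).
Proof.
assert (h : forall x, RtoC 0 = (RtoC 0 / RtoC (weight k x))%C)
  by (intros x; field; apply weight_C_neq0).
split; [|split].
- intros x; apply continuous_const.
- exists (RtoC 0); eapply filterlim_ext; [exact h | apply filterlim_const].
- exists (RtoC 0); eapply filterlim_ext; [exact h | apply filterlim_const].
Qed.

(** The shape [c * f + g] is one step of the [fold_right] in [lin_span], which suits induction on
    the list of terms. *)
Lemma in_Y_axpy (k : nat) (c : C) (f g : R -> C) :
  in_Y k f -> in_Y k g -> in_Y k (fun x => (c * f x + g x)%C).
Proof.
intros (hfc & (lp & hfp) & (lm & hfm)) (hgc & (mp & hgp) & (mm & hgm)).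
assert (h : forall x, (c * (f x / RtoC (weight k x)) + g x / RtoC (weight k x)
  = (c * f x + g x) / RtoC (weight k x))%C)
  by (intros x; field; apply weight_C_neq0).
split; [|split].
- intros x; apply continuous_Cplus; [apply continuous_Cscal|]; auto.
- exists (c * lp + mp)%C; eapply filterlim_ext; [exact h|].
  apply filterlim_Cplus; [apply filterlim_Cscal|]; assumption.
- exists (c * lm + mm)%C; eapply filterlim_ext; [exact h|].
  apply filterlim_Cplus; [apply filterlim_Cscal|]; assumption.
Qed.

Lemma ridge_lim (k : nat) (a b : R) (p : Rbar) (l : R) :
  filterlim (fun x => ReLU (a * x + b) ^ k / weight k x)
    (Rbar_locally p) (locally l) ->
  filterlim (fun x => (RtoC (ReLU (a * x + b) ^ k) / RtoC (weight k x))%C)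
    (Rbar_locally p) (locally (RtoC l)).
Proof.
intros h; eapply filterlim_ext; [|exact (filterlim_RtoC _ _ h)].
intros x; simpl; apply RtoC_div, Rgt_not_eq, weight_pos.
Qed.

Lemma ridge_in_Y (k : nat) (a b : R) : (1 <= k)%nat ->
  in_Y k (fun x => RtoC (ReLU (a * x + b) ^ k)).
Proof.
intros hk; split; [|split].
- intros x; apply (continuous_comp (fun y => ReLU (a * y + b) ^ k) RtoC);
    [apply continuous_ReLU_pow | apply continuous_RtoC].
- eexists; apply ridge_lim, ReLU_pow_lim_p, hk.
- eexists; apply ridge_lim, ReLU_pow_lim_m, hk.
Qed.

Lemma in_H_in_Y (k : nat) (g : R -> C) : (1 <= k)%nat -> in_H k g -> in_Y k g.
Proof.
intros hk (l & hl & hg).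
apply in_Y_ext with
  (fun x => fold_right (fun p s => (fst p * snd p x + s)%C) (RtoC 0) l);
  [now intros; rewrite hg|].
clear hg; induction hl as [|[c h] l (a & b & _ & hh) hl IH]; simpl.
- apply in_Y_zero.
- simpl in hh; apply in_Y_axpy; [|exact IH].
  apply in_Y_ext with (fun x => RtoC (ReLU (a * x + b) ^ k)).
  + now intros; rewrite hh.
  + now apply ridge_in_Y.
Qed.

(** * Closure properties of linear spans *)

Lemma lin_span_zero (S : (R -> C) -> Prop) : lin_span S (fun _ => RtoC 0).
Proof. exists nil; split; [constructor | easy]. Qed.

Lemma lin_span_ext (S : (R -> C) -> Prop) (f g : R -> C) :
  (forall x, f x = g x) -> lin_span S f -> lin_span S g.
Proof. intros e (l & hl & hf); exists l; split; [easy|]; now intros; rewrite <- e. Qed.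

Lemma lin_span_plus (S : (R -> C) -> Prop) (f g : R -> C) :
  lin_span S f -> lin_span S g -> lin_span S (fun x => (f x + g x)%C).
Proof.
intros (l & hl & hf) (m & hm & hg); exists (l ++ m); split.
- now apply Forall_app.
- intros x; rewrite hf, hg; clear; induction l as [|p l IH]; simpl; [ring|].
  rewrite <- IH; ring.
Qed.

Lemma lin_span_scal (S : (R -> C) -> Prop) (c : C) (f : R -> C) :
  lin_span S f -> lin_span S (fun x => (c * f x)%C).
Proof.
intros (l & hl & hf); exists (map (fun p => (c * fst p, snd p)%C) l); split.
- apply Forall_map; simpl; exact hl.
- intros x; rewrite hf; clear; induction l as [|p l IH]; simpl; [ring|].
  rewrite <- IH; ring.
Qed.

Lemma ridge_in_H (k : nat) (a b : R) :
  a <> 0 -> in_H k (fun x => RtoC (ReLU (a * x + b) ^ k)).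
Proof.
intros ha; exists ((RtoC 1, fun x => RtoC (ReLU (a * x + b) ^ k)) :: nil); split.
- constructor; [|constructor]; now exists a, b.
- intros x; simpl; ring.
Qed.

(** * Construction of the ramp *)

(** Pairs are (coefficient, shift). The function [phi] is a parameter so that one list serves for
    [y ^ k] and for [ReLU y ^ k]. *)
Definition shifts (phi : R -> R) (l : list (R * R)) (x : R) : R :=
  fold_right (fun p s => fst p * phi (x - snd p) + s) 0 l.

(** Differentiation lowers the degree but keeps coefficients and shifts, so a list representing 1 in
    degree [k] has constant derivative in degree [k + 1]. *)
Lemma is_derive_shifts_pow (k : nat) (l : list (R * R)) (x : R) :
  is_derive (shifts (fun y => y ^ S k) l) x
    (INR (S k) * shifts (fun y => y ^ k) l x).
Proof.
induction l as [|[c t] l IH].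
- unfold shifts; simpl; rewrite Rmult_0_r; apply (is_derive_const 0).
- apply is_derive_ext with
    (fun y => c * (y - t) ^ S k + shifts (fun z => z ^ S k) l y); [easy|].
  replace (INR (S k) * shifts (fun y => y ^ k) ((c, t) :: l) x)
    with (c * (INR (S k) * (x - t) ^ k) + INR (S k) * shifts (fun y => y ^ k) l x)
    by (unfold shifts; simpl fold_right; ring).
  apply (is_derive_plus (fun y => c * (y - t) ^ S k)); [|exact IH].
  auto_derive; [easy|].
  change (c * (1 * (INR (S k) * (x + - t) ^ k)) = c * (INR (S k) * (x - t) ^ k)).
  now rewrite Rmult_1_l.
Qed.

(* Integrating a representation of [1] in degree [k] gives
   [x + const] in degree [k + 1], and the difference of its values at [x] and
   [x - 1] is again [1]. *)
Lemma one_as_shifted_powers (k : nat) :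
  exists (l : list (R * R)) (T : R),
    List.Forall (fun p => 0 <= snd p <= T) l /\
    forall x, shifts (fun y => y ^ k) l x = 1.
Proof.
induction k as [|k (l & T & hl & h1)].
- exists ((1, 0) :: nil), 0; split.
  + constructor; [simpl; lra | constructor].
  (* Degree 0 needs a single term; [0 ^ 0 = 1] makes it correct at [x = 0] as well. *)
  + intros x; unfold shifts; simpl; ring.
- set (n := INR (S k)).
  assert (hn : 0 < n) by (apply lt_0_INR; lia).
  set (P := shifts (fun y => y ^ S k) l).
  (* The first half represents [P x / n], the second [- P (x - 1) / n]; moving the argument by 1
     raises the shifts by 1, hence the bound [T + 1]. *)
  exists (map (fun p => (fst p / n, snd p)) l ++
          map (fun p => (- fst p / n, snd p + 1)) l), (T + 1); split.
  + apply Forall_app; split; apply Forall_map; simpl;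
      apply Forall_impl with (2 := hl); simpl; intros; lra.
  + intros x.
    assert (hP : P x - P (x - 1) = n).
    (* The derivative of [P] is the constant [n], so the mean value theorem on an interval of length
       1 gives the increment exactly. *)
    { destruct (MVT_gen P (x - 1) x (fun _ => n)) as (c & _ & hc).
      - intros y _; replace n with (n * shifts (fun y => y ^ k) l y)
          by (rewrite h1; ring).
        apply is_derive_shifts_pow.
      - intros y _; apply continuity_pt_filterlim.
        apply (ex_derive_continuous P y).
        eexists; apply is_derive_shifts_pow.
      - rewrite hc; ring. }
    transitivity (/ n * (P x - P (x - 1))); [|rewrite hP; field; lra].
    clear hP.
    unfold P, shifts; cbv beta; rewrite fold_right_app.
    (* General in [z], because after [fold_right_app] the second sum is the initial value of the
       first. *)
    assert (h : forall z, fold_right (fun p s => fst p * (x - snd p) ^ S k + s) z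
        (map (fun p => (fst p / n, snd p)) l) =
      / n * fold_right (fun p s => fst p * (x - snd p) ^ S k + s) 0 l + z).
    { intros z; clear -hn; induction l as [|p l IH]; cbn [fold_right map fst snd].
      - ring.
      - rewrite IH; field; lra. }
    rewrite h.
    assert (h' : fold_right (fun p s => fst p * (x - snd p) ^ S k + s) 0
        (map (fun p => (- fst p / n, snd p + 1)) l) =
      - / n * fold_right (fun p s => fst p * (x - 1 - snd p) ^ S k + s) 0 l).
    { clear -hn; induction l as [|p l IH]; cbn [fold_right map fst snd].
      - ring.
      - rewrite IH; replace (x - (snd p + 1)) with (x - 1 - snd p) by ring.
        field; lra. }
    rewrite h'; field; lra.
Qed.

Lemma shifts_ReLU_pow_in_H (k : nat) (l : list (R * R)) (a b : R) : a <> 0 ->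
  in_H k (fun x => RtoC (shifts (fun y => ReLU y ^ k) l (a * x + b))).
Proof.
intros ha; induction l as [|[c t] l IH].
- apply lin_span_zero.
- apply lin_span_ext with (fun x => (RtoC c * RtoC (ReLU (a * x + (b - t)) ^ k)%R
    + RtoC (shifts (fun y => ReLU y ^ k) l (a * x + b))%R)%C).
  + intros x; unfold shifts; simpl; rewrite RtoC_plus, RtoC_mult.
    now replace (a * x + (b - t)) with (a * x + b - t) by ring.
  + apply lin_span_plus; [|exact IH].
    now apply lin_span_scal, ridge_in_H.
Qed.

(** Every argument is at most 0, and [1 <= k] turns [0 ^ k] into 0 (in degree 0 it would be 1). *)
Lemma shifts_ReLU_pow_neg (k : nat) (l : list (R * R)) (x : R) : (1 <= k)%nat ->
  List.Forall (fun p => x <= snd p) l -> shifts (fun y => ReLU y ^ k) l x = 0.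
Proof.
intros hk; induction 1 as [|p l hp hl IH]; [easy|].
unfold shifts in *; simpl; rewrite IH, ReLU_neg, pow_i by (lia || lra); ring.
Qed.

Lemma shifts_ReLU_pow_pos (k : nat) (l : list (R * R)) (x : R) :
  List.Forall (fun p => snd p <= x) l ->
  shifts (fun y => ReLU y ^ k) l x = shifts (fun y => y ^ k) l x.
Proof.
induction 1 as [|p l hp hl IH]; [easy|].
unfold shifts in *; simpl; rewrite IH, ReLU_pos by lra; ring.
Qed.

(** With nonnegative shifts, [ReLU (x - t)] is at most [Rmax 0 T] on [x <= T], which bounds each
    term there. *)
Lemma shifts_ReLU_pow_bounded (k : nat) (l : list (R * R)) (T : R) :
  List.Forall (fun p => 0 <= snd p) l ->
  exists M, forall x, x <= T -> Rabs (shifts (fun y => ReLU y ^ k) l x) <= M.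
Proof.
induction 1 as [|p l hp hl (M & IH)].
- exists 0; intros; unfold shifts; simpl; rewrite Rabs_R0; lra.
- exists (Rabs (fst p) * Rmax 0 T ^ k + M); intros x hx.
  specialize (IH x hx); unfold shifts in *; simpl.
  eapply Rle_trans; [apply Rabs_triang|]; apply Rplus_le_compat; [|exact IH].
  rewrite Rabs_mult; apply Rmult_le_compat_l; [apply Rabs_pos|].
  rewrite Rabs_pos_eq by apply pow_le, ReLU_ge0.
  apply pow_incr; split; [apply ReLU_ge0|].
  unfold ReLU; apply Rle_max_compat_l; lra.
Qed.

(** All shifts lie in [[0, T]]: to the left of 0 every [ReLU] vanishes, to the right of [T] each is
    the identity and the sum is 1. Rescaling the argument moves the transition into [[0, 1]]; no
    monotonicity is claimed, only the bound [M]. *)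
Lemma ramp_in_H (k : nat) : (1 <= k)%nat ->
  exists (s : R -> R) (M : R),
    (forall x, x <= 0 -> s x = 0) /\
    (forall x, 1 <= x -> s x = 1) /\
    (forall x, Rabs (s x) <= M) /\
    (forall a b, a <> 0 -> in_H k (fun x => RtoC (s (a * x + b)))).
Proof.
intros hk; destruct (one_as_shifted_powers k) as (l & T & hl & h1).
(* The maximum with 1 ensures a positive scaling factor. *)
set (T' := Rmax 1 T).
assert (hT1 : 1 <= T') by apply Rmax_l.
assert (hTT : T <= T') by apply Rmax_r.
set (r := shifts (fun y => ReLU y ^ k) l).
assert (hr1 : forall x, T' <= x -> r x = 1).
{ intros x hx; unfold r; rewrite shifts_ReLU_pow_pos; [apply h1|].
  apply Forall_impl with (2 := hl); simpl; intros; lra. }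
destruct (shifts_ReLU_pow_bounded k l T') as (M & hM).
{ apply Forall_impl with (2 := hl); simpl; intros; lra. }
exists (fun x => r (T' * x)), (Rmax 1 M); split; [|split; [|split]].
- intros x hx; apply shifts_ReLU_pow_neg; [easy|].
  apply Forall_impl with (2 := hl); simpl; intros; nra.
- intros x hx; apply hr1; nra.
- intros x; destruct (Rle_dec (T' * x) T') as [h|h].
  + eapply Rle_trans; [now apply hM | apply Rmax_r].
  + rewrite hr1, Rabs_R1 by lra; apply Rmax_l.
- intros a b ha; apply lin_span_ext with
    (fun x => RtoC (r ((T' * a) * x + T' * b))).
  + intros x; do 2 f_equal; ring.
  + apply shifts_ReLU_pow_in_H; nra.
Qed.

(** * Staircase approximation on a uniform grid *)

Definition node (x0 h : R) (n : nat) : R := x0 + INR n * h.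

(** Each step adds one increment of [f], switched on between consecutive nodes. The ramp argument is
    [(x - node) / h], written in the affine form [a * x + b] of the ridge functions. *)
Fixpoint staircase (f : R -> C) (s : R -> R) (x0 h : R) (n : nat) (x : R) : C :=
  match n with
  | O => RtoC 0
  | S m =>
      (staircase f s x0 h m x +
       (f (node x0 h (S m)) - f (node x0 h m)) *
       RtoC (s (/ h * x + - / h * node x0 h m)%R))%C
  end.

Lemma staircase_in_H (k : nat) (f : R -> C) (s : R -> R) (x0 h : R) (n : nat) :
  0 < h ->
  (forall a b, a <> 0 -> in_H k (fun x => RtoC (s (a * x + b)))) ->
  in_H k (staircase f s x0 h n).
Proof.
intros hh hs; induction n as [|n IH].
- apply lin_span_zero.
- apply (lin_span_plus _ (staircase f s x0 h n)); [exact IH|].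
  now apply lin_span_scal, hs, Rinv_neq_0_compat, Rgt_not_eq.
Qed.

Section Staircase.

Variables (f : R -> C) (s : R -> R) (x0 h M : R).
Hypotheses (hh : 0 < h)
  (s0 : forall x, x <= 0 -> s x = 0)
  (s1 : forall x, 1 <= x -> s x = 1)
  (sM : forall x, Rabs (s x) <= M).

Let xn : nat -> R := node x0 h.

Lemma ramp_left (n : nat) (x : R) :
  x <= xn n -> s (/ h * x + - / h * xn n) = 0.
Proof.
intros hx; apply s0.
replace (/ h * x + - / h * xn n) with (- (/ h * (xn n - x))) by ring.
assert (0 < / h) by now apply Rinv_0_lt_compat.
nra.
Qed.

Lemma ramp_right (n : nat) (x : R) :
  xn (S n) <= x -> s (/ h * x + - / h * xn n) = 1.
Proof.
intros hx; apply s1.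
apply Rmult_le_reg_l with h; [easy|].
replace (h * (/ h * x + - / h * xn n)) with (x - xn n) by (field; lra).
unfold xn, node in *; rewrite S_INR in hx; lra.
Qed.

Lemma node_le (n : nat) : x0 <= xn n <= xn (S n).
Proof. unfold xn, node; rewrite S_INR; assert (hn := pos_INR n); nra. Qed.

Lemma staircase_left (n : nat) (x : R) : x <= x0 -> staircase f s x0 h n x = 0%C.
Proof.
intros hx; induction n as [|n IH]; simpl staircase; [easy|].
fold xn; rewrite IH, ramp_left.
- ring.
- assert (hn := node_le n); lra.
Qed.

(** Every ramp has reached 1, so the increments telescope. *)
Lemma staircase_right (n : nat) (x : R) : xn n <= x ->
  staircase f s x0 h n x = (f (xn n) - f x0)%C.
Proof.
induction n as [|n IH]; intros hx.
- unfold xn, node; simpl; rewrite Rmult_0_l, Rplus_0_r; ring.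
- simpl staircase; fold xn; rewrite IH, ramp_right by
    (assert (hn := node_le n); lra).
  unfold xn, node; simpl INR; ring.
Qed.

(** Induction removes the last step while its ramp is still 0. In the last cell the earlier steps
    telescope, leaving the error [f x - f (xn n)] minus the last increment times a ramp value: at
    most [delta + M * delta]. *)
Lemma staircase_approx (delta : R) (n : nat) (x : R) :
  (forall y z, x0 <= y <= xn n -> x0 <= z <= xn n -> Rabs (y - z) <= h ->
     Cmod (f z - f y) <= delta) ->
  x0 <= x <= xn n ->
  Cmod (f x - f x0 - staircase f s x0 h n x) <= (1 + M) * delta.
Proof.
intros hf hx.
assert (hM : 0 <= M) by (eapply Rle_trans; [apply Rabs_pos | apply (sM 0)]).
(* The modulus hypothesis at [y = z = x] already forces this. *)
assert (hd : 0 <= delta).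
{ eapply Rle_trans; [apply Cmod_ge_0 | apply (hf x x)]; try easy.
  rewrite Rminus_diag, Rabs_R0; lra. }
induction n as [|n IH].
- assert (x = x0) as -> by (unfold xn, node in hx; simpl in hx; lra).
  simpl; replace (f x0 - f x0 - 0)%C with (RtoC 0) by ring.
  rewrite Cmod_0; nra.
- assert (hn := node_le n).
  destruct (Rle_dec x (xn n)) as [hxn|hxn].
  + simpl staircase; fold xn; rewrite ramp_left by easy.
    rewrite Cmult_0_r, Cplus_0_r; apply IH; [|lra].
    intros; apply hf; lra.
  + simpl staircase; rewrite staircase_right by lra; fold xn.
    set (c := s _).
    replace (f x - f x0 - (f (xn n) - f x0 + (f (xn (S n)) - f (xn n)) * c))%C
      with ((f x - f (xn n)) + - ((f (xn (S n)) - f (xn n)) * c))%C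
      by ring.
    eapply Rle_trans; [apply Cmod_triangle|].
    rewrite Cmod_opp, Cmod_mult, Cmod_R.
    assert (hs : xn (S n) = xn n + h)
      by (unfold xn, node; rewrite S_INR; ring).
    assert (h1 : Cmod (f x - f (xn n)) <= delta)
      by (apply hf; try rewrite Rabs_minus_sym, Rabs_pos_eq; lra).
    assert (h2 : Cmod (f (xn (S n)) - f (xn n)) <= delta)
      by (apply hf; try rewrite Rabs_minus_sym, Rabs_pos_eq; lra).
    assert (h3 : Rabs c <= M) by apply sM.
    assert (h4 := Rabs_pos c).
    assert (h5 := Cmod_ge_0 (f (xn (S n)) - f (xn n))).
    nra.
Qed.

End Staircase.

(** * Approximation of functions negligible against the weight *)

Lemma uniform_continuity_C (f : R -> C) (a b eps : R) :
  0 < eps -> (forall x, continuous f x) ->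
  exists d, 0 < d /\ forall x y, a <= x <= b -> a <= y <= b ->
    Rabs (y - x) < d -> Cmod (f x - f y) <= eps.
Proof.
intros he hf.
destruct (unifcont_normed_1d (V := C_NormedModule) f a b (fun x _ => hf x)
  (mkposreal eps he)) as (d & hd).
exists d; split; [apply cond_pos|]; intros x y hx hy hxy.
rewrite <- Cmod_opp; replace (- (f x - f y))%C with (f y - f x)%C by ring.
apply Rlt_le; exact (hd x y hx hy hxy).
Qed.

(** The tolerance [e = eps / (1 + M)] absorbs the ramp bound: the error against the weight is at
    most [(1 + M) * e] on the left tail and in the middle, and [2 * e] on the right tail. *)
Lemma approx_o_weight (k : nat) (f : R -> C) : (1 <= k)%nat ->
  (forall x, continuous f x) ->
  (forall eps, 0 < eps -> exists A, forall x, A <= Rabs x ->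
     Cmod (f x) <= eps * weight k x) ->
  forall eps, 0 < eps -> exists g, in_H k g /\
    forall x, Cmod (f x - g x) <= eps * weight k x.
Proof.
intros hk hc hf eps heps.
destruct (ramp_in_H k hk) as (s & M & s0 & s1 & sM & sH).
(* From [s 1 = 1]; it yields [2 * e <= (1 + M) * e] on the right tail. *)
assert (hM : 1 <= M) by (rewrite <- Rabs_R1, <- (s1 1) by lra; apply sM).
set (e := eps * / (1 + M)).
assert (hinv : 0 < / (1 + M)) by (apply Rinv_0_lt_compat; lra).
assert (he : 0 < e) by now apply Rmult_lt_0_compat.
assert (eE : (1 + M) * e = eps) by (unfold e; field; lra).
destruct (hf e he) as (A0 & hA0).
set (A := Rmax 1 A0).
assert (hA1 : 1 <= A) by apply Rmax_l.
assert (hA : forall x, A <= Rabs x -> Cmod (f x) <= e * weight k x).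
{ intros x hx; apply hA0; eapply Rle_trans; [apply Rmax_r | exact hx]. }
destruct (uniform_continuity_C f (- A) A e he hc) as (d & hd & hfd).
(* [N] cells on [[- A, A]] have width [2 * A / N], which this choice makes less than [d]. *)
destruct (archimed_cor1 (d * / (2 * A))) as (N & hN & hN0).
{ apply Rmult_lt_0_compat; [easy | apply Rinv_0_lt_compat; lra]. }
assert (hNp : 0 < INR N) by now apply lt_0_INR.
assert (hNi : 0 < / INR N) by now apply Rinv_0_lt_compat.
set (h := 2 * A * / INR N).
assert (hh : 0 < h) by (apply Rmult_lt_0_compat; lra).
assert (hhd : h < d).
{ unfold h; replace d with (2 * A * (d * / (2 * A))) by (field; lra).
  apply Rmult_lt_compat_l; lra. }
assert (hend : node (- A) h N = A) by (unfold node, h; field; lra).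
(* The staircase only reproduces [f - f (- A)] on [[- A, A]]. One further ramp, rising on
   [[- A - 1, - A]], supplies the constant [f (- A)]. *)
exists (fun x => (f (- A)%R * RtoC (s (1 * x + (A + 1))%R)
                  + staircase f s (- A)%R h N x)%C); split.
{ apply lin_span_plus; [|now apply staircase_in_H].
  now apply lin_span_scal, sH, R1_neq_R0. }
intros x.
assert (hw := weight_ge1 k x).
assert (RA : Rabs A = A) by (apply Rabs_pos_eq; lra).
assert (RA' : Rabs (- A) = A) by now rewrite Rabs_Ropp.
destruct (Rle_dec x (- A)) as [hxl|hxl].
- assert (Rx : A <= Rabs x) by (rewrite Rabs_left; lra).
  rewrite (staircase_left f s (- A) h hh s0) by easy.
  set (c := s _).
  replace (f x - (f (- A)%R * c + 0))%C with (f x + - (f (- A)%R * c))%C by ring.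
  eapply Rle_trans; [apply Cmod_triangle|].
  rewrite Cmod_opp, Cmod_mult, Cmod_R.
  assert (h1 := hA x Rx).
  (* The bound at [- A] carries over to [x] because the weight grows with the absolute value. *)
  assert (h2 : Cmod (f (- A)) <= e * weight k x).
  { eapply Rle_trans; [apply hA; lra|].
    apply Rmult_le_compat_l; [lra | apply weight_le; lra]. }
  assert (h3 : Rabs c <= M) by apply sM.
  assert (h4 := Rabs_pos c).
  assert (h5 := Cmod_ge_0 (f (- A))).
  rewrite <- eE; nra.
- rewrite s1 by lra.
  destruct (Rle_dec x A) as [hxr|hxr].
  + replace (f x - (f (- A)%R * 1 + staircase f s (- A)%R h N x))%C
      with (f x - f (- A)%R - staircase f s (- A)%R h N x)%C by ring.
    (* As the weight is at least 1, an absolute error of [eps] suffices here. *)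
    apply Rle_trans with eps; [|nra].
    rewrite <- eE; apply (staircase_approx f s (- A) h M hh s0 s1 sM).
    * rewrite hend; intros y z hy hz hyz; apply hfd; [easy | easy |].
      now apply Rle_lt_trans with h.
    * rewrite hend; lra.
  + rewrite (staircase_right f s (- A) h hh s1) by (rewrite hend; lra).
    rewrite hend.
    replace (f x - (f (- A)%R * 1 + (f A - f (- A)%R)))%C with (f x + - f A)%C by ring.
    eapply Rle_trans; [apply Cmod_triangle|]; rewrite Cmod_opp.
    assert (Rx : Rabs x = x) by (apply Rabs_pos_eq; lra).
    assert (h1 : Cmod (f x) <= e * weight k x) by (apply hA; lra).
    assert (h2 : Cmod (f A) <= e * weight k x).
    { apply Rle_trans with (e * weight k A); [apply hA; lra|].
      apply Rmult_le_compat_l; [lra | apply weight_le; lra]. }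
    assert (h3 : 0 <= e * weight k x) by (apply Rmult_le_pos; lra).
    rewrite <- eE; nra.
Qed.

(** * From zero limits to smallness against the weight, and density *)

Lemma Cmod_div_weight (k : nat) (f : R -> C) (x : R) :
  Cmod (f x / RtoC (weight k x)) = Cmod (f x) / weight k x.
Proof.
rewrite Cmod_div by apply weight_C_neq0.
rewrite Cmod_R, Rabs_pos_eq; [easy | apply Rlt_le, weight_pos].
Qed.

Lemma Y_lim_0_bound (k : nat) (f : R -> C) (p : Rbar) (eps : R) :
  filterlim (fun x => (f x / RtoC (weight k x))%C)
    (Rbar_locally p) (locally (RtoC 0)) ->
  0 < eps -> Rbar_locally p (fun x => Cmod (f x) <= eps * weight k x).
Proof.
intros hf he.
assert (H := proj1 (filterlim_locally_ball_norm (U := C_NormedModule) _ _) hf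
  (mkposreal eps he)).
eapply filter_imp; [|exact H]; intros x hx.
change (Cmod (f x / RtoC (weight k x) - 0) < eps) in hx.
replace (f x / RtoC (weight k x) - 0)%C with (f x / RtoC (weight k x))%C in hx by ring.
rewrite Cmod_div_weight in hx.
assert (hw := weight_pos k x).
replace (Cmod (f x)) with (Cmod (f x) / weight k x * weight k x) by (field; lra).
nra.
Qed.

Lemma lim0_o_weight (k : nat) (f : R -> C) :
  filterlim (fun x => (f x / RtoC (weight k x))%C)
    (Rbar_locally p_infty) (locally (RtoC 0)) ->
  filterlim (fun x => (f x / RtoC (weight k x))%C)
    (Rbar_locally m_infty) (locally (RtoC 0)) ->
  forall eps, 0 < eps -> exists A, forall x, A <= Rabs x ->
    Cmod (f x) <= eps * weight k x.
Proof.
intros hp hm eps he.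
destruct (Y_lim_0_bound k f p_infty eps hp he) as (P & hP).
destruct (Y_lim_0_bound k f m_infty eps hm he) as (Q & hQ).
(* This exceeds both [P] and [- Q]; the 1 supplies the strict inequality in neighbourhoods of
   infinity. *)
exists (Rabs P + Rabs Q + 1); intros x hx.
assert (h1 := Rle_abs P); assert (h2 := Rle_abs (- Q)).
assert (h3 := Rabs_pos P); assert (h4 := Rabs_pos Q); rewrite Rabs_Ropp in h2.
revert hx; unfold Rabs at 3; destruct (Rcase_abs x); intros hx.
- apply hQ; lra.
- apply hP; lra.
Qed.

Lemma Y_norm_le (k : nat) (f : R -> C) (B : R) :
  (forall x, Cmod (f x) <= B * weight k x) -> Rbar_le (Y_norm k f) (Finite B).
Proof.
intros hf; apply Lub_Rbar_correct; intros y (x & ->); simpl.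
apply Rle_div_l; [apply weight_pos | apply hf].
Qed.

Theorem theorem1p1 (k : nat) (hk : (1 <= k)%nat) :
  dense_subset_wrt (Y_norm k) (in_H k) (in_Y k).
Proof.
split; [now intros; apply in_H_in_Y|].
intros f (hc & (lp & hp) & (lm & hm)) eps he.
(* Divided by the weight, [rp] tends to 1 at plus infinity and 0 at minus infinity; [rm] does the
   opposite. The coefficients [lp] and [lm] therefore match the two limits independently. *)
set (rp := fun x => RtoC (ReLU (1 * x + 0) ^ k)).
set (rm := fun x => RtoC (ReLU (-1 * x + 0) ^ k)).
assert (hr : in_H k (fun x => (lp * rp x + lm * rm x)%C)).
{ apply lin_span_plus; apply lin_span_scal, ridge_in_H; lra. }
set (f0 := fun x => (f x + (- lp * rp x + - lm * rm x))%C).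
assert (E : forall x, (f x / RtoC (weight k x) +
    (- lp * (rp x / RtoC (weight k x)) + - lm * (rm x / RtoC (weight k x)))
  = f0 x / RtoC (weight k x))%C).
{ intros x; unfold f0; field; apply weight_C_neq0. }
(* A supremum only inherits a non-strict bound, so [eps / 2] is used to end strictly below [eps]. *)
destruct (approx_o_weight k f0 hk) with (eps := eps / 2) as (g & hg & hfg).
- intros x; apply continuous_Cplus; [apply hc|].
  apply continuous_Cplus; apply continuous_Cscal; now apply ridge_in_Y.
- apply lim0_o_weight.
  + eapply filterlim_ext; [exact E|].
    replace (RtoC 0) with
      (lp + (- lp * RtoC (ReLU 1 ^ k)%R + - lm * RtoC (ReLU (- 1) ^ k)%R))%C.
    2:{ rewrite ReLU_pos, ReLU_neg, pow1, pow_i by (lia || lra); ring. }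
    apply filterlim_Cplus; [exact hp|].
    apply filterlim_Cplus; apply filterlim_Cscal;
      now apply ridge_lim, ReLU_pow_lim_p.
  + eapply filterlim_ext; [exact E|].
    replace (RtoC 0) with
      (lm + (- lp * RtoC (ReLU (- 1) ^ k)%R + - lm * RtoC (ReLU (- -1) ^ k)%R))%C.
    2:{ replace (- -1) with 1 by ring.
        rewrite (ReLU_pos 1), ReLU_neg, pow1, pow_i by (lia || lra); ring. }
    apply filterlim_Cplus; [exact hm|].
    apply filterlim_Cplus; apply filterlim_Cscal;
      now apply ridge_lim, ReLU_pow_lim_m.
- lra.
(* Adding back the subtracted ridge functions leaves the error equal to [f0 - g]. *)
- exists (fun x => (g x + (lp * rp x + lm * rm x))%C); split.
  + now apply lin_span_plus.
  + apply Rbar_le_lt_trans with (Finite (eps / 2)); [|simpl; lra].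
    apply Y_norm_le; intros x; eapply Rle_trans; [|apply (hfg x)].
    right; f_equal; unfold f0; ring.
Qed.
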